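(* Let $G$ be a countably infinite group and let $(N_n)_{n\in\mathbb{N}}$ be a sequence of normal finite-index subgroups of $G$ whose indices $|G/N_n|$, $n\in\mathbb{N}$, are pairwise coprime. Then, for any sequence $(g_n)_{n\in\mathbb{N}}$ in $G$, the set $A=G\setminus\bigcup_{n\in\mathbb{N}}g_nN_n$ is not piecewise syndetic.
   Context: For a countably infinite semigroup $G$, $A\subseteq G$ and $g\in G$, write $g^{-1}A=\{x\in G: gx\in A\}$, and for $H\subseteq G$ write $H^{-1}A=\bigcup_{h\in H}h^{-1}A$. A set $A\subseteq G$ is (right) thick if for every finite $F\subseteq G$ there is $g\in G$ with $Fg\subseteq A$; it is (right) piecewise syndetic if there is a finite $H\subseteq G$ such that $H^{-1}A$ is thick. *)

(* Defs.v *)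
From mathcomp Require Import all_boot finmap.
From mathcomp Require Import boolp classical_sets functions cardinality.

Set Implicit Arguments.
Unset Strict Implicit.
Unset Printing Implicit Defensive.

Local Open Scope classical_set_scope.
Local Open Scope group_scope.

Section Semigroup.
Variable G : semigroupType.
Implicit Types A H : set G.

(* g^-1 A; no inverse of g is assumed to exist. *)
Definition inv_translate (g : G) A : set G := [set x | A (g * x)].

(* H^-1 A *)
Definition inv_translates H A : set G := \bigcup_(h in H) inv_translate h A.

Definition thick A : Prop :=
  forall F : set G, finite_set F ->
    exists g : G, [set f * g | f in F] `<=` A.

Definition piecewise_syndetic A : Prop :=
  exists H : set G, finite_set H /\ thick (inv_translates H A).

End Semigroup.

Section Group.
Variable G : groupType.
Implicit Types N : set G.

Definition left_coset (g : G) N : set G := [set g * x | x in N].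

Definition left_cosets N : set (set G) := [set left_coset g N | g in [set: G]].

Definition is_subgroup N : Prop := group_closed [in N].

(* [x ^ g] is the conjugate g^-1 * x * g. *)
Definition is_normal_subgroup N : Prop :=
  is_subgroup N /\ forall g x : G, N x -> N (x ^ g).

Definition finite_index N : Prop := finite_set (left_cosets N).

(* Meaningful only when [finite_index N]: [fset_set] sends infinite sets to the
   empty finite set, so the value is 0 for a subgroup of infinite index. *)
Definition subgroup_index N : nat := #|` fset_set (left_cosets N)|%fset.

End Group.

(* Main.v *)
Require Import Defs.
From mathcomp Require Import all_boot finmap.
From mathcomp Require Import fingroup perm action cyclic.
From mathcomp Require Import boolp classical_sets functions cardinality.

(** Write [A] for the complement of the union of the cosets [g n * N n], and let
    [H = {h_0, ..., h_(k-1)}] be any finite subset of [G].  To see that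
    [H^-1 A] is not thick, a finite set [F] is needed such that no translate
    [F x] lies in [H^-1 A].

    By coprimality, [G] maps onto the product of the quotients [G / N i] for
    [i < k]; hence there is a finite set [F] meeting every intersection of
    cosets [a_i N_i], [i < k] ([finite_common_transversal]).  Given [x], apply
    this to [a_i = h_i^-1 (g i) x^-1]: some [f] in [F] satisfies
    [h_i f x \in g_i N_i] for every [i < k].  The point [f x] is thus sent
    outside [A] by every element of [H], i.e. it is not in [H^-1 A].

    The surjectivity is a Chinese remainder theorem for a group that need not be
    commutative.  It can be proved with powers only, without computing the index
    of an intersection: if [m] is the index of a normal subgroup [N], then
    [x ^+ m] is in [N] for all [x] ([expg_index]), so the coset of [x ^+ e]
    depends only on [e] modulo [m].  If [f] is right modulo [N_0, ..., N_(k-1)]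
    and [r] is right modulo [N_k], then so is [f ^+ e * r ^+ d] modulo all of
    them, where [e] is 1 modulo the first [k] indices and 0 modulo the last,
    and [d] is the other way round. *)

Set Implicit Arguments.
Unset Strict Implicit.

Local Open Scope classical_set_scope.
Local Open Scope card_scope.
Local Open Scope group_scope.

Section Cosets.
Variables (G : groupType) (N : set G).

Lemma left_cosetP (x y : G) : left_coset x N y <-> N (x^-1 * y).
Proof.
split=> [[z Nz <-]|Nxy]; first by rewrite mulKg.
by exists (x^-1 * y); rewrite ?mulVKg.
Qed.

Lemma translate_left_coset (x y : G) :
  [set x * z | z in left_coset y N] = left_coset (x * y) N.
Proof.
by rewrite /left_coset image_comp; apply: eq_imagel => z _ /=; rewrite mulgA.
Qed.

Hypothesis N_sub : is_subgroup N.

Lemma subgroup1 : N 1.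
Proof. by case: N_sub => /set_mem. Qed.

Lemma subgroupM (x y : G) : N x -> N y -> N (x * y).
Proof.
by move=> /mem_set Nx /mem_set Ny; apply/set_mem/(group_closedM N_sub).
Qed.

Lemma subgroupV (x : G) : N x -> N x^-1.
Proof. by move=> /mem_set Nx; apply/set_mem/(group_closedV N_sub). Qed.

Lemma subgroupX (x : G) k : N x -> N (x ^+ k).
Proof.
move=> Nx; elim: k => [|k IHk]; first exact: subgroup1.
by rewrite expgS; apply: subgroupM.
Qed.

Lemma left_coset_refl (x : G) : left_coset x N x.
Proof. by apply/left_cosetP; rewrite mulVg; apply: subgroup1. Qed.

Lemma eq_left_cosetP (x y : G) :
  left_coset x N = left_coset y N <-> N (x^-1 * y).
Proof.
split=> [eqxy|Nxy].
  by apply/left_cosetP; rewrite eqxy; apply: left_coset_refl.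
apply/seteqP; split=> z /left_cosetP Nz; apply/left_cosetP.
  have -> : y^-1 * z = (x^-1 * y)^-1 * (x^-1 * z).
    by rewrite invMg invgK -mulgA mulVKg.
  exact/subgroupM/Nz/subgroupV.
have -> : x^-1 * z = (x^-1 * y) * (y^-1 * z) by rewrite -mulgA mulVKg.
exact: subgroupM.
Qed.

End Cosets.

(** The cyclic group generated by [p] acts freely, so all of its orbits have
    [#[p]] elements and [#[p]] divides [#|T|]. *)
Lemma free_perm_expg_card (T : finType) (p : {perm T}) :
  (forall k t, (p ^+ k) t = t -> p ^+ k = 1) -> p ^+ #|T| = 1.
Proof.
move=> p_free; apply/eqP; rewrite -order_dvdn -cardsT.
have pT : [acts <[p]>, on [set: T]%SET | 'P].
  apply/fintype.subsetP => q _; rewrite !inE /=.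
  by apply/fintype.subsetP => t _; rewrite !inE.
rewrite -(acts_sum_card_orbit pT); apply: dvdn_sum => O /imsetP[t _ ->].
have := card_orbit_stab 'P <[p]>%G t.
suff -> : 'C_(<[p]>)[t | 'P]%g = 1%g by rewrite cards1 muln1 => ->.
apply/trivgP; apply/fintype.subsetP => q.
rewrite inE => /andP[/cycleP[k ->]] /astab1P /p_free ->.
by rewrite inE.
Qed.

Section NormalFiniteIndex.
Variables (G : groupType) (N : set G).
Hypothesis N_normal : is_normal_subgroup N.
Let N_sub : is_subgroup N := proj1 N_normal.

(** Multiplication of cosets of a normal subgroup is well defined.  With this
    congruence rule, equality of cosets serves below in place of computations
    in a quotient group. *)
Lemma eq_left_cosetM (x x' y y' : G) :
  left_coset x N = left_coset x' N -> left_coset y N = left_coset y' N ->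
  left_coset (x * y) N = left_coset (x' * y') N.
Proof.
move=> /(eq_left_cosetP N_sub) Nx eqy.
rewrite -(translate_left_coset _ x') -eqy translate_left_coset.
apply/(eq_left_cosetP N_sub).
by have := N_normal.2 y _ Nx; rewrite conjgE invMg !mulgA.
Qed.

Lemma eq_left_cosetMr (x g : G) :
  left_coset (x * g) N = left_coset g N <-> N x.
Proof.
split=> [eqxg|Nx].
  have := eq_left_cosetM eqxg (erefl (left_coset g^-1 N)).
  rewrite mulgK mulgV => /esym/(eq_left_cosetP N_sub).
  by rewrite invg1 mul1g.
rewrite -[g in RHS]mul1g; apply: eq_left_cosetM => //.
by apply/(eq_left_cosetP N_sub); rewrite mulg1; apply: subgroupV.
Qed.

Hypothesis N_fin : finite_index N.

(** Left translation by [x] permutes the finite set of cosets, and by normality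
    [x ^+ k] fixes one coset exactly when it lies in [N], in which case it
    fixes all of them: the permutation generates a free action. *)
Lemma expg_index (x : G) : N (x ^+ subgroup_index N).
Proof.
pose C := fset_set (left_cosets N).
have CP (A : set G) : (A \in C) = (A \in left_cosets N) by rewrite in_fset_set.
pose shift (y : G) (A : set G) : set G := [set y * z | z in A].
have shiftC y (A : C) : shift y (val A) \in C.
  have := valP A; rewrite !CP => /set_mem[a _ eA]; apply/mem_set.
  by exists (y * a) => //; rewrite -eA /shift translate_left_coset.
pose s (A : C) : C := [` shiftC x A]%fset.
have s_inj : injective s.
  move=> A B /(congr1 val) /= eqAB; apply: val_inj.
  have sK (D : set G) : shift x^-1 (shift x D) = D.
    rewrite /shift image_comp -[RHS]image_id.
    by apply: eq_imagel => z _ /=; rewrite mulKg.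
  by rewrite -[LHS]sK eqAB sK.
pose p := perm s_inj.
have pX k (A : C) : val ((p ^+ k) A) = shift (x ^+ k) (val A).
  elim: k => [|k IHk].
    rewrite expg0 perm1 /shift -[LHS]image_id.
    by apply: eq_imagel => z _; rewrite mul1g.
  rewrite expgSr permM permE /= IHk /shift image_comp.
  by apply: eq_imagel => z _ /=; rewrite expgS mulgA.
have pXP k (A : C) : (p ^+ k) A = A <-> N (x ^+ k).
  have := valP A; rewrite CP => /set_mem[a _ eA].
  split=> [/(congr1 val)|Nxk].
    by rewrite pX -eA /shift translate_left_coset => /eq_left_cosetMr.
  apply: val_inj; rewrite pX -eA /shift translate_left_coset.
  exact/eq_left_cosetMr.
have p1 : p ^+ #|{: C}| = 1.
  apply: free_perm_expg_card => k A /pXP Nxk.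
  by apply/permP => B; rewrite perm1; apply/pXP.
have NC : left_coset 1 N \in C by rewrite CP; apply/mem_set; exists 1.
apply/(pXP _ [` NC]%fset).
by rewrite /subgroup_index -/C cardfE p1 perm1.
Qed.

Lemma eq_left_coset_expg (x : G) k l :
  k = l %[mod subgroup_index N] ->
  left_coset (x ^+ k) N = left_coset (x ^+ l) N.
Proof.
suff red j :
    left_coset (x ^+ j) N = left_coset (x ^+ (j %% subgroup_index N)) N.
  by move=> eqkl; rewrite red eqkl -red.
rewrite {1}(divn_eq j (subgroup_index N)) expgD mulnC expgM.
by apply/eq_left_cosetMr; apply: subgroupX => //; apply: expg_index.
Qed.

End NormalFiniteIndex.

Lemma finite_left_coset_transversal (G : groupType) (N : set G) :
  finite_index N ->
  exists2 R : set G, finite_set R &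
    forall x, exists2 r, R r & left_coset r N = left_coset x N.
Proof.
move=> N_fin.
have repr (A : set G) : exists r, left_cosets N A -> left_coset r N = A.
  have [[r _ <-]|nA] := pselect (left_cosets N A); first by exists r.
  by exists 1.
have [rho rhoP] := choice repr.
exists (rho @` left_cosets N); first exact: finite_image.
move=> x; exists (rho (left_coset x N)).
  by exists (left_coset x N) => //; exists x.
by apply: rhoP; exists x.
Qed.

(** The Chinese remainder theorem for [N 0, ..., N k.-1].  One finite [F] has to
    serve all systems of congruences, because thickness fixes the finite set
    before the translating element is known.  Finiteness propagates since the
    exponents [e] and [d] below depend on the indices only, not on the
    system. *)
Lemma finite_common_transversal (G : groupType) (N : nat -> set G)
    (N_normal : forall n, is_normal_subgroup (N n))
    (N_finite_index : forall n, finite_index (N n))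
    (N_coprime : forall m n, m <> n ->
       coprime (subgroup_index (N m)) (subgroup_index (N n))) (k : nat) :
  exists2 F : set G, finite_set F &
    forall a : nat -> G, exists2 f, F f &
      forall i, i < k -> left_coset f (N i) = left_coset (a i) (N i).
Proof.
elim: k => [|k [F F_fin FP]].
  by exists [set 1]; [exact: finite_set1 | move=> a; exists 1].
have [R R_fin RP] := finite_left_coset_transversal (N_finite_index k).
pose M := (\prod_(i < k) subgroup_index (N i))%N.
have coM : coprime M (subgroup_index (N k)).
  apply: (big_ind (coprime^~ (subgroup_index (N k)))).
  - exact: coprime1n.
  - by move=> u v cu cv; rewrite coprimeMl cu cv.
  - case=> i ltik _ /=.
    by apply: N_coprime => eik; rewrite eik ltnn in ltik.
have dvdM i : i < k -> subgroup_index (N i) %| M.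
  by move=> ltik; rewrite /M (bigD1 (Ordinal ltik)) //= dvdn_mulr.
pose e := chinese M (subgroup_index (N k)) 1 0.
pose d := chinese M (subgroup_index (N k)) 0 1.
exists [set f ^+ e * r ^+ d | f in F & r in R]; first exact: finite_image2.
move=> a; have [f Ff fP] := FP a; have [r Rr rP] := RP (a k).
exists (f ^+ e * r ^+ d); first by exists f => //; exists r.
move=> i; rewrite ltnS leq_eqVlt => /predU1P[->|ltik].
  rewrite -rP -[r in RHS]mul1g; apply: eq_left_cosetM => //.
    by apply: (eq_left_coset_expg _ _ f (l := 0)) => //; apply: chinese_modr.
  by apply: (eq_left_coset_expg _ _ r (l := 1)) => //; apply: chinese_modr.
have modN u v : u = v %[mod M] -> u = v %[mod subgroup_index (N i)].
  move=> /(congr1 (modn^~ (subgroup_index (N i)))).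
  by rewrite /= !modn_dvdm ?dvdM.
rewrite -(fP i ltik) -[f in RHS]mulg1; apply: eq_left_cosetM => //.
  by apply: (eq_left_coset_expg _ _ f (l := 1)) => //; apply/modN/chinese_modl.
by apply: (eq_left_coset_expg _ _ r (l := 0)) => //; apply/modN/chinese_modl.
Qed.

Local Close Scope group_scope.
Unset Implicit Arguments.
Set Strict Implicit.

Theorem theorem14 (G : groupType) (N : nat -> set G) (g : nat -> G)
    (G_countably_infinite : [set: G] #= [set: nat])
    (N_normal : forall n, is_normal_subgroup (N n))
    (N_finite_index : forall n, finite_index (N n))
    (N_coprime : forall m n, m <> n ->
       coprime (subgroup_index (N m)) (subgroup_index (N n))) :
  ~ piecewise_syndetic ([set: G] `\` \bigcup_n left_coset (g n) (N n)).
Proof.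
move=> [H [/finite_seqP[s ->] thickA]].
have [F F_fin FP] :=
  finite_common_transversal N_normal N_finite_index N_coprime (size s).
have [x FxA] := thickA F F_fin.
(* With f in a_i N_i, normality gives s_i f x in s_i a_i x N_i = g_i N_i. *)
pose a i := ((nth 1 s i)^-1 * g i * x^-1)%g.
have [f Ff fP] := FP a.
have /FxA[h /= hs [_ notU]] : [set (f * x)%g | f in F] (f * x)%g by exists f.
apply: notU; exists (index h s) => //.
have := fP (index h s); rewrite index_mem => /(_ hs) eqf.
suff <- : left_coset (h * (f * x))%g (N (index h s)) =
          left_coset (g (index h s)) (N (index h s)).
  exact/left_coset_refl/(N_normal _).1.
rewrite -translate_left_coset.
rewrite (eq_left_cosetM (N_normal _) eqf (erefl (left_coset x _))).
by rewrite translate_left_coset /a nth_index // mulgKV mulVKg.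
Qed.
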